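(* Let $v\in[\mathbb{Z}^\infty*\mathbb{Z}^\infty,\ \mathbb{Z}^\infty*\mathbb{Z}^\infty]$ be a word of reduced length $N$. Then for all natural numbers $r,s\geq N$ we have $\operatorname{scl}(v)\in \operatorname{scl}(\mathbb{Z}^r*\mathbb{Z}^s)$.
   Context: $\mathbb{Z}^\infty$ denotes the free abelian group on countably many generators, and $*$ denotes the free product of groups. For a group $G$ and $g\in[G,G]$, $\operatorname{cl}(g)$ is the least number of commutators in $G$ whose product is $g$, and the stable commutator length is $\operatorname{scl}(g)=\lim_{k\to\infty}\operatorname{cl}(g^k)/k$. For a group $G$ put $\operatorname{scl}(G)=\{\operatorname{scl}(g): g\in[G,G]\}$ (the image of $\operatorname{scl}$, computed in $G$). Write $A$ and $B$ for the left and right free factor of $\mathbb{Z}^\infty*\mathbb{Z}^\infty$. All words considered lie in the commutator subgroup of $A*B$, start in $A$ and end in $B$, i.e. they have the form $w=u_1v_1u_2v_2\cdots u_nv_n$ with $n\ge 1$, $u_i\in A\setminus\{1\}$, $v_i\in B\setminus\{1\}$. The reduced length of such a $w$ is $2n$. *)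

(* Defs.v *)
From HB Require Import structures.
From mathcomp Require Import all_boot all_order all_algebra.
From mathcomp Require Import all_classical all_reals all_analysis.
From mathcomp Require Import freeg.

Set Implicit Arguments.
Unset Strict Implicit.
Unset Printing Implicit Defensive.

Import numFieldNormedType.Exports.

Local Open Scope classical_set_scope.
Local Open Scope group_scope.

(* The free product of two groups is realised on reduced words: alternating   *)
(* lists of non-trivial syllables, [inl a] standing for a in A and [inr b]    *)
(* for b in B. The product [word_mul u w] pushes the syllables of u, from     *)
(* right to left, onto w.                                                     *)
Section ReducedWords.
Variables A B : groupType.
Implicit Types (a : A) (b : B) (x y : A + B) (u w : seq (A + B)).

Definition trivial_syllable x : bool :=
  match x with inl a => a == 1 | inr b => b == 1 end.

Definition reduced_word w : bool :=
  all (predC trivial_syllable) w && sorted (fun x y => is_inl x != is_inl y) w.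

Definition cons_nontrivial x w : seq (A + B) :=
  if trivial_syllable x then w else x :: w.

Definition push x w : seq (A + B) :=
  match x, w with
  | inl a, inl a' :: w' => cons_nontrivial (inl (a * a')) w'
  | inr b, inr b' :: w' => cons_nontrivial (inr (b * b')) w'
  | _, _ => cons_nontrivial x w
  end.

Definition word_mul u w : seq (A + B) := foldr push w u.

Definition syllable_inv x : A + B :=
  match x with inl a => inl a^-1 | inr b => inr b^-1 end.

Definition word_inv w : seq (A + B) := rev (map syllable_inv w).

Let starts_off (s : bool) w := if w is y :: _ then is_inl y != s else true.

Lemma reduced_cons x w :
  reduced_word (x :: w) =
  [&& ~~ trivial_syllable x, starts_off (is_inl x) w & reduced_word w].
Proof.
rewrite /reduced_word /=; case: w => [|y w] /=; first by rewrite !andbT.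
by rewrite [is_inl y == _]eq_sym -!andbA; do !bool_congr.
Qed.

Lemma reduced_cons_nontrivial x w :
  starts_off (is_inl x) w -> reduced_word w ->
  reduced_word (cons_nontrivial x w).
Proof.
by rewrite /cons_nontrivial => ? ?; case: ifPn => // ?; rewrite reduced_cons; apply/and3P.
Qed.

Lemma reduced_word_inl w : reduced_word w -> exists a w',
  [/\ w = cons_nontrivial (inl a) w', starts_off true w' & reduced_word w'].
Proof.
rewrite /cons_nontrivial.
case: w => [|[a|b] w] rw; try by exists 1; eexists; rewrite /= eqxx.
by move: rw; rewrite reduced_cons => /and3P[/negbTE a1 ? ?]; exists a, w; rewrite a1.
Qed.

Lemma reduced_word_inr w : reduced_word w -> exists b w',
  [/\ w = cons_nontrivial (inr b) w', starts_off false w' & reduced_word w'].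
Proof.
rewrite /cons_nontrivial.
case: w => [|[a|b] w] rw; try by exists 1; eexists; rewrite /= eqxx.
by move: rw; rewrite reduced_cons => /and3P[/negbTE b1 ? ?]; exists b, w; rewrite b1.
Qed.

Lemma push_cons_inl a a' w : starts_off true w ->
  push (inl a) (cons_nontrivial (inl a') w) = cons_nontrivial (inl (a * a')) w.
Proof.
rewrite {1}/cons_nontrivial /= => sw; case: eqP => [->|//].
by rewrite mulg1; case: w sw => [|[]].
Qed.

Lemma push_cons_inr b b' w : starts_off false w ->
  push (inr b) (cons_nontrivial (inr b') w) = cons_nontrivial (inr (b * b')) w.
Proof.
rewrite {1}/cons_nontrivial /= => sw; case: eqP => [->|//].
by rewrite mulg1; case: w sw => [|[]].
Qed.

Lemma reduced_push x w : reduced_word w -> reduced_word (push x w).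
Proof.
case: x => [a|b].
  move=> /reduced_word_inl[a' [w' [-> sw rw]]].
  by rewrite push_cons_inl //; apply: reduced_cons_nontrivial.
move=> /reduced_word_inr[b' [w' [-> sw rw]]].
by rewrite push_cons_inr //; apply: reduced_cons_nontrivial.
Qed.

Lemma reduced_mul u w : reduced_word w -> reduced_word (word_mul u w).
Proof. by move=> rw; elim: u => //= x u; apply: reduced_push. Qed.

Lemma push_inl a a' w : reduced_word w ->
  push (inl a) (push (inl a') w) = push (inl (a * a')) w.
Proof.
by move=> /reduced_word_inl[c [w' [-> sw rw]]]; do !rewrite push_cons_inl //; rewrite mulgA.
Qed.

Lemma push_inr b b' w : reduced_word w ->
  push (inr b) (push (inr b') w) = push (inr (b * b')) w.
Proof.
by move=> /reduced_word_inr[c [w' [-> sw rw]]]; do !rewrite push_cons_inr //; rewrite mulgA.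
Qed.

Lemma push_trivial x w : trivial_syllable x -> reduced_word w -> push x w = w.
Proof.
case: x => c /eqP->.
  by move=> /reduced_word_inl[a [w' [-> sw rw]]]; rewrite push_cons_inl ?mul1g.
by move=> /reduced_word_inr[b [w' [-> sw rw]]]; rewrite push_cons_inr ?mul1g.
Qed.

Lemma mul_cons_nontrivial x u w : reduced_word w ->
  word_mul (cons_nontrivial x u) w = push x (word_mul u w).
Proof.
move=> rw; rewrite /cons_nontrivial; case: ifP => // x1.
by rewrite push_trivial ?reduced_mul.
Qed.

Lemma mul_push x u w : reduced_word u -> reduced_word w ->
  word_mul (push x u) w = push x (word_mul u w).
Proof.
move=> ru rw; case: x => [a|b].
  have [a' [u' [-> su ru']]] := reduced_word_inl ru.
  by rewrite push_cons_inl // !mul_cons_nontrivial // push_inl ?reduced_mul.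
have [b' [u' [-> su ru']]] := reduced_word_inr ru.
by rewrite push_cons_inr // !mul_cons_nontrivial // push_inr ?reduced_mul.
Qed.

Lemma word_mulA u v w : reduced_word v -> reduced_word w ->
  word_mul u (word_mul v w) = word_mul (word_mul u v) w.
Proof.
by move=> rv rw; elim: u => //= x u ->; rewrite mul_push ?reduced_mul.
Qed.

Lemma word_mulw0 u : reduced_word u -> word_mul u [::] = u.
Proof.
elim: u => //= x u IHu; rewrite reduced_cons => /and3P[/negbTE x1 su /IHu->].
by case: x su x1 => [a|b]; case: u {IHu} => [|[] ? ?] //= _ x1;
  rewrite /cons_nontrivial /= x1.
Qed.

Lemma push_syllable_inv x w : reduced_word (x :: w) ->
  push (syllable_inv x) (x :: w) = w.
Proof.
by case: x => c _ /=; rewrite mulVg /cons_nontrivial /= eqxx.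
Qed.

Lemma word_mulVw u : reduced_word u -> word_mul (word_inv u) u = [::].
Proof.
rewrite /word_inv /word_mul; elim: u => //= x u IHu rxu.
rewrite rev_cons foldr_rcons push_syllable_inv // IHu //.
by move: rxu; rewrite reduced_cons => /and3P[].
Qed.

Lemma syllable_invK : involutive syllable_inv.
Proof. by case=> c /=; rewrite invgK. Qed.

Lemma word_invK : involutive word_inv.
Proof.
by move=> u; rewrite /word_inv map_rev revK mapK //; apply: syllable_invK.
Qed.

Lemma reduced_inv u : reduced_word u -> reduced_word (word_inv u).
Proof.
rewrite /reduced_word /word_inv all_rev rev_sorted all_map sorted_map.
rewrite (eq_all (a2 := predC trivial_syllable)); last first.
  by case=> c /=; rewrite -(inj_eq invg_inj) invgK invg1.
by rewrite (eq_sorted (e' := fun x y => is_inl x != is_inl y)) => // -[] ? [] ?.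
Qed.

End ReducedWords.

Record free_product (A B : groupType) := FreeProduct {
  syllables :> seq (A + B);
  syllables_reduced : reduced_word syllables
}.

HB.instance Definition _ (A B : groupType) := [isSub for @syllables A B].
HB.instance Definition _ (A B : groupType) :=
  [Choice of free_product A B by <:].

Section FreeProductGroup.
Variables A B : groupType.
Implicit Types u v w : free_product A B.

Definition fp_one : free_product A B := @FreeProduct A B [::] isT.

Definition fp_mul u w : free_product A B :=
  FreeProduct (reduced_mul u (syllables_reduced w)).

Definition fp_inv u : free_product A B :=
  FreeProduct (reduced_inv (syllables_reduced u)).

Lemma fp_mulA : associative fp_mul.
Proof. by move=> u v w; apply: val_inj; apply: word_mulA; apply: syllables_reduced. Qed.

Lemma fp_mul1g : left_id fp_one fp_mul.
Proof. by move=> u; apply: val_inj. Qed.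

Lemma fp_mulg1 : right_id fp_one fp_mul.
Proof. by move=> u; apply/val_inj/word_mulw0/syllables_reduced. Qed.

Lemma fp_mulVg : left_inverse fp_one fp_inv fp_mul.
Proof. by move=> u; apply/val_inj/word_mulVw/syllables_reduced. Qed.

Lemma fp_mulgV : right_inverse fp_one fp_inv fp_mul.
Proof.
move=> u; rewrite -{1}[u](_ : fp_inv (fp_inv u) = u) ?fp_mulVg //.
by apply/val_inj/word_invK.
Qed.

HB.instance Definition _ := isGroup.Build (free_product A B)
  fp_mulA fp_mul1g fp_mulg1 fp_mulVg fp_mulgV.

Definition fp_inl (a : A) : free_product A B :=
  FreeProduct (@reduced_push A B (inl a) [::] isT).

Definition fp_inr (b : B) : free_product A B :=
  FreeProduct (@reduced_push A B (inr b) [::] isT).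

Lemma fp_inl_is_group_morphism a a' : fp_inl (a * a') = fp_inl a * fp_inl a'.
Proof.
apply: val_inj; rewrite [LHS](esym (@push_inl A B a a' [::] isT)).
by rewrite [RHS](@mul_push _ _ (inl a) [::] (push (inl a') [::])) // reduced_push.
Qed.

Lemma fp_inr_is_group_morphism b b' : fp_inr (b * b') = fp_inr b * fp_inr b'.
Proof.
apply: val_inj; rewrite [LHS](esym (@push_inr A B b b' [::] isT)).
by rewrite [RHS](@mul_push _ _ (inr b) [::] (push (inr b') [::])) // reduced_push.
Qed.

Definition reduced_length w : nat := size (syllables w).

Definition starts_left_ends_right w : Prop :=
  exists (n : nat) (u : 'I_n -> A) (v : 'I_n -> B),
    [/\ (0 < n)%N, forall i, u i != 1, forall i, v i != 1 &
        w = \prod_(i < n) (fp_inl (u i) * fp_inr (v i))].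

End FreeProductGroup.

Section StableCommutatorLength.
Variable G : groupType.

Definition commutator_product (n : nat) : set G :=
  [set g | exists x y : 'I_n -> G, g = \prod_(i < n) [~ x i, y i]].

(* The subgroup generated by the commutators, which form a set closed under   *)
(* inversion.                                                                 *)
Definition commutator_subgroup : set G := \bigcup_n commutator_product n.

(* Only meaningful on the commutator subgroup; 0 elsewhere.                   *)
Definition cl (g : G) : nat :=
  xget 0%N [set n | commutator_product n g /\
                    forall m, commutator_product m g -> (n <= m)%N].

(* The limit exists on the commutator subgroup, by subadditivity of           *)
(* k |-> cl (g ^+ k); the value of the quotient at k = 0 is irrelevant.       *)
Definition scl (R : realType) (g : G) : R :=
  limn (fun k : nat => (cl (g ^+ k))%:R / k%:R : R)%R.

End StableCommutatorLength.

Arguments commutator_subgroup : clear implicits.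

Definition scl_spectrum (R : realType) (G : groupType) : set R :=
  [set scl R g | g in commutator_subgroup G].

Arguments scl_spectrum : clear implicits.

(* Free abelian group on the set I of generators, written multiplicatively.   *)
Definition free_abelian (I : choiceType) : groupType :=
  Algebra.to_multiplicative {freeg I / int}.

Definition Zpow (r : nat) : groupType := free_abelian 'I_r.

Definition Zinf : groupType := free_abelian nat.

(* Main.v *)
Require Import Defs.
From mathcomp Require Import all_boot all_order all_algebra.
From mathcomp Require Import all_classical all_reals all_analysis.
From HB Require Import structures.
From mathcomp Require Import freeg.

(** Group morphisms cannot increase commutator length. Hence if f : G -> H and
g : H -> G are morphisms with g (f v) = v for a single element v, then f v and
all its powers have the same commutator length in H as v and its powers have in
G, so scl (f v) = scl v ([scl_retract]).

It therefore suffices to map the free product of two copies of Z^oo to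
Z^r * Z^s and back so that v is recovered. By functoriality ([fp_map_retract])
this can be done one factor at a time: a morphism Z^oo -> Z^r and one back are
needed whose composite fixes the syllables of v in the left factor, and likewise
on the right. There are at most N <= r such syllables. The matrix of their
coordinates has at most r rows, and the Smith normal form factors it through
Z^r by integer matrices multiplying the rows on the right ([int_mx_factor]);
these matrices are the two morphisms ([free_abelian_factor]). The Smith form enters because the
subgroup spanned by the syllables need not be a direct summand of Z^oo, whereas
its saturation is one, of the same rank. *)

Set Implicit Arguments.
Unset Strict Implicit.
Unset Printing Implicit Defensive.

Local Open Scope classical_set_scope.
Local Open Scope group_scope.

Notation group_morphism := UMagmaMorphism.type.

(** * Stable commutator length under group morphisms *)

Lemma commutator_product_morph (G H : groupType) (f : group_morphism G H) n g :
  commutator_product n g -> commutator_product n (f g).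
Proof.
move=> [x [y ->]]; exists (f \o x), (f \o y).
by rewrite gmulf_prod; apply: eq_bigr => i _; rewrite gmulfR.
Qed.

Lemma commutator_subgroup_morph (G H : groupType) (f : group_morphism G H) g :
  commutator_subgroup G g -> commutator_subgroup H (f g).
Proof. by move=> [n _ gn]; exists n => //; apply: commutator_product_morph. Qed.

Lemma cl_retract (G H : groupType) (f : group_morphism G H) (g : group_morphism H G) v :
  g (f v) = v -> cl (f v) = cl v.
Proof.
move=> gfv; rewrite /cl.
have E n : commutator_product n (f v) = commutator_product n v.
  apply/propext; split => [/(commutator_product_morph g)|]; first by rewrite gfv.
  exact: commutator_product_morph.
congr xget; apply/seteqP; split => n [/= vn min_n].
  by split=> [|m]; rewrite -E //; apply: min_n.
by split=> [|m]; rewrite E //; apply: min_n.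
Qed.

Lemma scl_retract (G H : groupType) (R : realType) (f : group_morphism G H)
    (g : group_morphism H G) v :
  g (f v) = v -> scl R (f v) = scl R v.
Proof.
move=> gfv; rewrite /scl; under eq_fun => k.
  by rewrite -gmulfXn (@cl_retract _ _ f g) ?gmulfXn ?gfv //; over.
by [].
Qed.

(** * The universal property of the free product *)

Section FreeProductLift.
Variables A B : groupType.

HB.instance Definition _ := isMultiplicative.Build A (free_product A B)
  (@fp_inl A B) (@fp_inl_is_group_morphism A B).
HB.instance Definition _ := isMultiplicative.Build B (free_product A B)
  (@fp_inr A B) (@fp_inr_is_group_morphism A B).

Lemma fp_inl1 : @fp_inl A B 1 = 1.
Proof. by apply: val_inj; rewrite /= /cons_nontrivial /= eqxx. Qed.

Lemma fp_inr1 : @fp_inr A B 1 = 1.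
Proof. by apply: val_inj; rewrite /= /cons_nontrivial /= eqxx. Qed.

HB.instance Definition _ := Multiplicative_isUMagmaMorphism.Build
  A (free_product A B) (@fp_inl A B) fp_inl1.
HB.instance Definition _ := Multiplicative_isUMagmaMorphism.Build
  B (free_product A B) (@fp_inr A B) fp_inr1.

Definition fp_letter (x : A + B) : free_product A B :=
  match x with inl a => fp_inl B a | inr b => fp_inr A b end.

(** Multiplying by a letter on the left is [push], and pushing the syllables of a
reduced word one after the other rebuilds the word ([word_mulw0]). *)
Lemma prod_letters (v : free_product A B) :
  v = \prod_(x <- syllables v) fp_letter x.
Proof.
apply: val_inj; case: v => w rw /=.
rewrite -[w in LHS](word_mulw0 rw) {rw}.
elim: w => [|x w IHw]; first by rewrite big_nil.
rewrite big_cons /= IHw; set p := \prod_(_ <- _) _.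
rewrite [RHS](_ : _ = word_mul (cons_nontrivial x [::]) p); last by case: x.
by rewrite mul_cons_nontrivial ?syllables_reduced.
Qed.

Variables (G : groupType) (h : group_morphism A G) (k : group_morphism B G).

Definition letter_image (x : A + B) : G :=
  match x with inl a => h a | inr b => k b end.

(** Defined on all words, not only reduced ones, so that the morphism property can
be proved by pushing one syllable at a time. *)
Definition word_image (w : seq (A + B)) : G := \prod_(x <- w) letter_image x.

Definition fp_lift (v : free_product A B) : G := word_image v.

Lemma word_image_cons_nontrivial x w :
  word_image (cons_nontrivial x w) = letter_image x * word_image w.
Proof.
rewrite /cons_nontrivial /word_image; case: ifPn => [|_]; last by rewrite big_cons.
by case: x => c /= /eqP->; rewrite gmulf1 mul1g.
Qed.

Lemma word_image_push x w :
  word_image (push x w) = letter_image x * word_image w.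
Proof.
case: x w => [a|b] [|[a'|b'] w]; rewrite /= word_image_cons_nontrivial //=.
  by rewrite gmulfM -mulgA {2}/word_image big_cons.
by rewrite gmulfM -mulgA {2}/word_image big_cons.
Qed.

Lemma fp_liftM : {morph fp_lift : u v / u * v}.
Proof.
case=> u ru v; rewrite /fp_lift /= {ru}; elim: u => [|x u IHu] /=.
  by rewrite {2}/word_image big_nil mul1g.
by rewrite word_image_push IHu {3}/word_image big_cons mulgA.
Qed.

Lemma fp_lift1 : fp_lift 1 = 1.
Proof. exact: big_nil. Qed.

HB.instance Definition _ :=
  isMultiplicative.Build (free_product A B) G fp_lift fp_liftM.
HB.instance Definition _ :=
  Multiplicative_isUMagmaMorphism.Build (free_product A B) G
    fp_lift fp_lift1.

Lemma fp_lift_inl a : fp_lift (fp_inl B a) = h a.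
Proof. by rewrite [LHS](@word_image_push (inl a)) {1}/word_image big_nil mulg1. Qed.

Lemma fp_lift_inr b : fp_lift (fp_inr A b) = k b.
Proof. by rewrite [LHS](@word_image_push (inr b)) {1}/word_image big_nil mulg1. Qed.

End FreeProductLift.

Definition fp_map (A B A' B' : groupType)
    (f : group_morphism A A') (g : group_morphism B B') :
    group_morphism (free_product A B) (free_product A' B') :=
  fp_lift (@fp_inl A' B' \o f) (@fp_inr A' B' \o g).

(** The first map sends v to a product of images of its letters. Some of these may
be trivial, so the product need not be in reduced form; but the second map, being
a morphism, can be applied to each factor, where it restores the letter. *)
Lemma fp_map_retract (A B A' B' : groupType)
    (f : group_morphism A A') (f' : group_morphism A' A)
    (g : group_morphism B B') (g' : group_morphism B' B)
    (v : free_product A B) :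
  (forall a, inl a \in syllables v -> f' (f a) = a) ->
  (forall b, inr b \in syllables v -> g' (g b) = b) ->
  fp_map f' g' (fp_map f g v) = v.
Proof.
move=> fK gK; rewrite [fp_map f g v](_ : _ =
  \prod_(x <- syllables v) letter_image (@fp_inl A' B' \o f) (@fp_inr A' B' \o g) x) //.
rewrite gmulf_prod [RHS]prod_letters big_seq [RHS]big_seq.
apply: eq_bigr => -[a /fK|b /gK] fgK /=.
  by rewrite [LHS]fp_lift_inl /= fgK.
by rewrite [LHS]fp_lift_inr /= fgK.
Qed.

(** * Finitely many elements of a free abelian group *)

Section FreeAbelian.
Local Open Scope ring_scope.
Import GRing.Theory.

(** In the Smith normal form M = L D R only the first m columns of D can be
nonzero, so after undoing R the remaining columns may be cut off and padded back
with zeros. Hence P consists of the first m columns of R^-1 and Q of the first m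
rows of R, completed by zeros up to size r. *)
Lemma int_mx_factor m n r (M : 'M[int]_(m, n)) : (m <= r)%N ->
  exists (P : 'M[int]_(n, r)) (Q : 'M[int]_(r, n)), M *m P *m Q = M.
Proof.
move=> le_mr; have [L _ [R unitR [d _ ->]]] := int_Smith_normal_form M.
exists (invmx R *m pid_mx m), (pid_mx m *m R).
rewrite !mulmxA mulmxK // -!mulmxA (mulmxA (pid_mx m)) pid_mx_id //.
rewrite (mulmxA (\matrix_(i, j) _)); do 2!congr (_ *m _).
apply/matrixP => i j; rewrite mxE (bigD1 j) //= big1 ?addr0.
  rewrite !mxE eqxx /=; case: ltnP => [_|le_mj]; first by rewrite mulr1.
  by rewrite mulr0 ltn_eqF ?(leq_trans (ltn_ord i)).
move=> k neq_kj; rewrite !mxE (_ : (k == j :> nat) = false) ?mulr0 //.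
exact: negbTE neq_kj.
Qed.

Section Coordinates.
Variables (I : choiceType) (n : nat) (b : n.-tuple I).

Definition coordinates (x : {freeg I / int}) : 'rV[int]_n :=
  \row_i coeff (tnth b i) x.

Definition combination (c : 'rV[int]_n) : {freeg I / int} :=
  \sum_i << c 0 i *g tnth b i >>.

Lemma coordinates_is_zmod_morphism : zmod_morphism coordinates.
Proof. by move=> x y; apply/rowP => i; rewrite !mxE coeffB. Qed.

Lemma combination_is_zmod_morphism : zmod_morphism combination.
Proof.
move=> c d; rewrite -sumrB; apply: eq_bigr => i _.
by rewrite !mxE freegUB.
Qed.

HB.instance Definition _ := GRing.isZmodMorphism.Build _ _
  coordinates coordinates_is_zmod_morphism.
HB.instance Definition _ := GRing.isZmodMorphism.Build _ _
  combination combination_is_zmod_morphism.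

Lemma combinationK : uniq b -> cancel combination coordinates.
Proof.
move=> ub c; apply/rowP => i; rewrite mxE raddf_sum (bigD1 i) //= big1.
  by rewrite coeffU eqxx mulr1 addr0.
move=> j neq_ji; rewrite coeffU; case: eqP => [eq_ji|]; last by rewrite mulr0.
by case/eqP: neq_ji; apply/(tuple_uniqP _ ub).
Qed.

Lemma coordinatesK x : uniq b -> {subset dom x <= b} ->
  combination (coordinates x) = x.
Proof.
move=> ub sxb; apply/eqP/freeg_eqP => y.
have [y_b|y_notin_b] := boolP (y \in b).
  have [i ->] := tnthP _ _ y_b.
  by have /rowP/(_ i) := combinationK ub (coordinates x); rewrite !mxE.
rewrite [RHS]coeff_outdom; last by apply: contra y_notin_b => /sxb.
rewrite raddf_sum big1 //= => i _; rewrite coeffU; case: eqP => [eq_iy|].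
  by case/negP: y_notin_b; rewrite -eq_iy mem_tnth.
by rewrite mulr0.
Qed.

End Coordinates.

(** On the finitely many basis elements that occur in s, the coordinates of s form
a matrix with size s rows; its factorization through Z^r is transported to the
free abelian groups. *)
Lemma freeg_factor (I : choiceType) (s : seq {freeg I / int}) r :
  (size s <= r)%N ->
  exists (f : {additive {freeg I / int} -> {freeg 'I_r / int}})
         (g : {additive {freeg 'I_r / int} -> {freeg I / int}}),
    {in s, cancel f g}.
Proof.
move=> le_sr; pose b := in_tuple (undup (flatten (map (@dom _ _) s))).
have ub : uniq b by apply: undup_uniq.
have sub_dom x : x \in s -> {subset dom x <= b}.
  by move=> xs y yx; rewrite mem_undup; apply/flatten_mapP; exists x.
pose M := \matrix_(i < size s) coordinates b (tnth (in_tuple s) i).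
have [P [Q MPQ]] := int_mx_factor M le_sr.
exists (combination (ord_tuple r) \o mulmxr P \o coordinates b).
exists (combination b \o mulmxr Q \o coordinates (ord_tuple r)).
move=> x xs /=; rewrite combinationK; last by rewrite val_ord_tuple enum_uniq.
have [i x_i] := tnthP (in_tuple s) x xs.
have -> : coordinates b x = row i M by rewrite rowK -x_i.
by rewrite -!row_mul MPQ rowK -x_i coordinatesK //; apply: sub_dom.
Qed.

End FreeAbelian.

Lemma free_abelian_factor (I : choiceType) (s : seq (free_abelian I)) r :
  (size s <= r)%N ->
  exists (f : group_morphism (free_abelian I) (Zpow r))
         (g : group_morphism (Zpow r) (free_abelian I)),
    {in s, cancel f g}.
Proof.
move=> /(@freeg_factor I s)[f [g fK]].
by exists (Algebra.to_fmultiplicative f), (Algebra.to_fmultiplicative g).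
Qed.

Theorem mainTheorem1 (R : realType) (N : nat) (v : free_product Zinf Zinf) :
  commutator_subgroup (free_product Zinf Zinf) v ->
  starts_left_ends_right v ->
  reduced_length v = N ->
  forall r s : nat, (N <= r)%N -> (N <= s)%N ->
    scl_spectrum R (free_product (Zpow r) (Zpow s)) (scl R v).
Proof.
move=> v_comm _ <- r s le_r le_s.
pose lefts : seq Zinf := pmap (fun x => if x is inl a then Some a else None) v.
pose rights : seq Zinf := pmap (fun x => if x is inr b then Some b else None) v.
have [|f [f' fK]] := @free_abelian_factor nat lefts r.
  by apply: leq_trans le_r; rewrite size_pmap count_size.
have [|g [g' gK]] := @free_abelian_factor nat rights s.
  by apply: leq_trans le_s; rewrite size_pmap count_size.
have vK : fp_map f' g' (fp_map f g v) = v.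
  apply: fp_map_retract => [a va|b vb].
    by apply: fK; rewrite mem_pmap; apply/mapP; exists (inl a).
  by apply: gK; rewrite mem_pmap; apply/mapP; exists (inr b).
exists (fp_map f g v); first exact: commutator_subgroup_morph.
exact: scl_retract vK.
Qed.
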